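(* Let $N\geqslant 3$ be an integer and let $\gamma\geqslant -2$ be real. Put $2^*(\gamma)=\frac{2(N+\gamma)}{N-2}$. Then for any $q>2^*(\gamma)$ there is no embedding from $H_r^1(\mathbb{R}^N)$ into $L^q(\mathbb{R}^N;|x|^\gamma)$, and the embedding $H_r^1(\mathbb{R}^N)\hookrightarrow L^{2^*(\gamma)}(\mathbb{R}^N;|x|^\gamma)$ is not compact.
   Context: $H_r^1(\mathbb{R}^N)$ is the completion of $C_{0,r}^\infty(\mathbb{R}^N)$ (radial smooth compactly supported real functions) under the norm $\|u\|=\left(\int_{\mathbb{R}^N}(|\nabla u|^2+|u|^2)\,dx\right)^{1/2}$. For $q\geqslant 1$, $L^q(\mathbb{R}^N;|x|^\gamma)$ is the space of measurable $u:\mathbb{R}^N\to\mathbb{R}$ with $\int_{\mathbb{R}^N}|x|^\gamma|u|^q\,dx<\infty$, with norm $\left(\int_{\mathbb{R}^N}|x|^\gamma|u|^q\,dx\right)^{1/q}$. ''Embedding'' means continuous inclusion: there is a constant $C$ with $\|u\|_{L^q(\mathbb{R}^N;|x|^\gamma)}\leqslant C\|u\|$ for all $u\in H_r^1(\mathbb{R}^N)$. It is known that the embedding into $L^{2^*(\gamma)}(\mathbb{R}^N;|x|^\gamma)$ is continuous. *)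

(* Defs.v *)
From HB Require Import structures.
From mathcomp Require Import all_boot all_order all_algebra.
From mathcomp Require Import all_classical all_reals all_analysis.

Set Implicit Arguments.
Unset Strict Implicit.
Unset Printing Implicit Defensive.

Import Order.TTheory GRing.Theory Num.Theory.
Import numFieldNormedType.Exports.

Local Open Scope classical_set_scope.
Local Open Scope ring_scope.

(* The sigma-algebra on row vectors is the one generated by the coordinates,
   as the library does for tuples: it is the Borel sigma-algebra of R^n. *)
Definition measure_rV_display : measure_display.
Proof. exact: default_measure_display. Qed.

Section measurable_rV.
Context {R : realType} (n : nat).

Definition rV_coord (i : 'I_n) (x : 'rV[R]_n) : R := x ord0 i.

Let rV_set0 : g_sigma_preimage rV_coord set0.
Proof. exact: sigma_algebra0. Qed.

Let rV_setC A : g_sigma_preimage rV_coord A -> g_sigma_preimage rV_coord (~` A).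
Proof. exact: sigma_algebraC. Qed.

Let rV_bigcup (F : (set 'rV[R]_n)^nat) :
  (forall i, g_sigma_preimage rV_coord (F i)) ->
  g_sigma_preimage rV_coord (\bigcup_i (F i)).
Proof. exact: sigma_algebra_bigcup. Qed.

HB.instance Definition _ := @isMeasurable.Build measure_rV_display
  'rV[R]_n (g_sigma_preimage rV_coord) rV_set0 rV_setC rV_bigcup.

Lemma measurable_rV_coord (i : 'I_n) :
  measurable_fun [set: 'rV[R]_n] (rV_coord i).
Proof.
move=> _ Y mY; rewrite setTI; apply: sub_sigma_algebra => /=.
rewrite -bigcup_seq/=; exists i => /=; first by rewrite mem_index_enum.
by exists Y => //; rewrite setTI.
Qed.

Lemma measurable_fun_rVP d (T : measurableType d) (f : T -> 'rV[R]_n) :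
  (forall i, measurable_fun [set: T] (rV_coord i \o f)) ->
  measurable_fun [set: T] f.
Proof.
move=> mf.
suff : g_sigma_preimage (fun i => rV_coord i \o f) `<=` measurable.
  by rewrite g_sigma_preimage_comp => H _ A mA; apply: H; exists A.
apply: smallest_sub; first exact: sigma_algebra_measurable.
rewrite -bigcup_seq; apply: bigcup_sub => i _ A [B mB <-].
exact: mf.
Qed.

End measurable_rV.

Section lebesgue_rV.
Context {R : realType}.

Definition rV_cons n (p : R * 'rV[R]_n) : 'rV[R]_n.+1 :=
  row_mx (p.1)%:M p.2 : 'rV[R]_(1 + n).

Definition rV_uncons n (x : 'rV[R]_n.+1) : R * 'rV[R]_n :=
  (x ord0 ord0, \row_i x ord0 (lift ord0 i)).

Lemma rV_consK n : cancel (@rV_cons n) (@rV_uncons n).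
Proof.
move=> [a x]; rewrite /rV_cons /rV_uncons; congr (_, _) => /=.
  rewrite (_ : ord0 = lshift n (ord0 : 'I_1)); last exact/val_inj.
  by rewrite (@row_mxEl _ 1 1 n) mxE.
apply/rowP => i; rewrite mxE.
rewrite (_ : lift ord0 i = rshift 1 i); last exact/val_inj.
by rewrite (@row_mxEr _ 1 1 n).
Qed.

Lemma rV_consE0 n (p : R * 'rV[R]_n) : rV_cons p ord0 ord0 = p.1.
Proof. by have := congr1 fst (rV_consK p). Qed.

Lemma rV_consES n (p : R * 'rV[R]_n) i :
  rV_cons p ord0 (lift ord0 i) = p.2 ord0 i.
Proof. by have /rowP/(_ i) := congr1 snd (rV_consK p); rewrite mxE. Qed.

Lemma rV_unconsK n : cancel (@rV_uncons n) (@rV_cons n).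
Proof.
move=> x; apply/rowP => i.
have [j ->|->] := unliftP ord0 i; last by rewrite rV_consE0.
by rewrite rV_consES mxE.
Qed.

Lemma measurable_rV_cons n : measurable_fun [set: R * 'rV[R]_n] (@rV_cons n).
Proof.
apply: measurable_fun_rVP => i.
have [j ->|->] := unliftP ord0 i.
  rewrite (_ : _ \o _ = rV_coord j \o snd).
    by apply: measurableT_comp => //; exact: measurable_rV_coord.
  by apply/funext => p /=; exact: rV_consES.
rewrite (_ : _ \o _ = fst); first exact: measurable_fst.
by apply/funext => p /=; exact: rV_consE0.
Qed.

Lemma measurable_rV_uncons n : measurable_fun [set: 'rV[R]_n.+1] (@rV_uncons n).
Proof.
apply/measurable_fun_pairP; split; first exact: (measurable_rV_coord ord0).
apply: measurable_fun_rVP => i.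
rewrite (_ : _ \o _ = rV_coord (lift ord0 i)); first exact: measurable_rV_coord.
by apply/funext => x /=; rewrite /rV_coord mxE.
Qed.

Section cons_measure.
Variables (n : nat) (mu : {sigma_finite_measure set 'rV[R]_n -> \bar R}).

Definition rV_cons_measure : set 'rV[R]_n.+1 -> \bar R :=
  pushforward (@lebesgue_measure R \x mu)%E (@rV_cons n).

Let rV_cons_measure0 : rV_cons_measure set0 = 0%E.
Proof. by rewrite /rV_cons_measure /pushforward preimage_set0 measure0. Qed.

Let rV_cons_measure_ge0 A : (0 <= rV_cons_measure A)%E.
Proof. by rewrite /rV_cons_measure /pushforward; exact: measure_ge0. Qed.

Let rV_cons_measure_sigma_additive : semi_sigma_additive rV_cons_measure.
Proof.
move=> F mF tF mUF; rewrite /rV_cons_measure /pushforward preimage_bigcup.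
have mcons A : measurable A -> measurable (@rV_cons n @^-1` A).
  by move=> mA; rewrite -[X in measurable X]setTI; exact: measurable_rV_cons.
apply: measure_semi_sigma_additive.
- by move=> k; exact: mcons.
- apply/trivIsetP => /= i j _ _ ij; rewrite -preimage_setI.
  by move/trivIsetP : tF => /(_ _ _ _ _ ij) ->//; rewrite preimage_set0.
- by rewrite -preimage_bigcup; exact: mcons.
Qed.

HB.instance Definition _ := isMeasure.Build _ _ _ rV_cons_measure
  rV_cons_measure0 rV_cons_measure_ge0 rV_cons_measure_sigma_additive.

Let rV_cons_measure_sigma_finite : sigma_finite setT rV_cons_measure.
Proof.
have /sigma_finiteP[F [TF ndF Foo]] := sigma_finiteT (@lebesgue_measure R).
have /sigma_finiteP[G [TG ndG Goo]] := sigma_finiteT mu.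
exists (fun k => @rV_uncons n @^-1` (F k `*` G k)).
  rewrite -preimage_bigcup (_ : \bigcup_k _ = setT) ?preimage_setT//.
  apply/seteqP; split => // -[x y] _.
  have [i _ Fx] : (\bigcup_k F k) x by rewrite -TF.
  have [j _ Gy] : (\bigcup_k G k) y by rewrite -TG.
  exists (maxn i j) => //; split => /=.
    by move: x Fx; exact/subsetPset/ndF/leq_maxl.
  by move: y Gy; exact/subsetPset/ndG/leq_maxr.
move=> k; have [mF Fkoo] := Foo k; have [mG Gkoo] := Goo k; split.
  rewrite -[X in measurable X]setTI; apply: measurable_rV_uncons => //.
  exact: measurableX.
rewrite /rV_cons_measure /pushforward -comp_preimage.
rewrite (_ : _ \o _ = id); last by apply/funext => p; exact: rV_consK.
by rewrite preimage_id product_measure1E// lte_mul_pinfty// ge0_fin_numE.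
Qed.

HB.instance Definition _ := Measure_isSigmaFinite.Build _ _ _
  rV_cons_measure rV_cons_measure_sigma_finite.

End cons_measure.

Fixpoint lebesgue_rV n : {sigma_finite_measure set 'rV[R]_n -> \bar R} :=
  match n with
  | 0 => [the {sigma_finite_measure set _ -> \bar R} of dirac (0 : 'rV[R]_0)]
  | m.+1 => [the {sigma_finite_measure set _ -> \bar R} of
             rV_cons_measure (lebesgue_rV m)]
  end.

Lemma lebesgue_rV_box n (A : 'I_n -> set R) :
  (forall i, measurable (A i)) ->
  lebesgue_rV n [set x | forall i, A i (x ord0 i)] =
  (\prod_(i < n) @lebesgue_measure R (A i))%E.
Proof.
elim: n A => [|n IHn] A mA.
  by rewrite big_ord0 /= diracE mem_set// => -[].
have mB : measurable [set x : 'rV[R]_n | forall i, A (lift ord0 i) (x ord0 i)].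
  rewrite (_ : mkset _ =
      \big[setI/setT]_(i < n) (rV_coord i @^-1` A (lift ord0 i))).
    apply: bigsetI_measurable => i _.
    by rewrite -[X in measurable X]setTI; exact: measurable_rV_coord.
  rewrite -bigcap_seq; apply/seteqP; split => x /= h i.
    by move=> _; exact: h.
  exact: (h i (mem_index_enum i)).
rewrite big_ord_recl -IHn// -product_measure1E//; last exact: (mA ord0).
rewrite /= /rV_cons_measure /pushforward; congr (_ _).
apply/seteqP; split => [p /= h|p [/= h0 h] i].
  split => [|i] /=; first by have := h ord0; rewrite rV_consE0.
  by have := h (lift ord0 i); rewrite rV_consES.
have [j ->|->] := unliftP ord0 i; last by rewrite rV_consE0.
by rewrite rV_consES; exact: h.
Qed.

End lebesgue_rV.

Section function_spaces.
Context {R : realType} {N : nat}.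
Implicit Types (f u : 'rV[R]_N -> R) (gamma q : R).

Local Notation mu := (@lebesgue_rV R N).

(* The norm that the library puts on 'rV[R]_N is the sup norm. *)
Definition enorm (x : 'rV[R]_N) : R := Num.sqrt (\sum_(i < N) x ord0 i ^+ 2).

Definition partial (i : 'I_N) f : 'rV[R]_N -> R :=
  fun x => 'D_(delta_mx ord0 i) f x.

Definition gradient f (x : 'rV[R]_N) : 'rV[R]_N := \row_i partial i f x.

Definition smooth f := forall s : seq 'I_N,
  continuous (foldr partial f s) /\
  forall (i : 'I_N) x, derivable (foldr partial f s) x (delta_mx ord0 i).

Definition radial f := forall x y, enorm x = enorm y -> f x = f y.

Definition compactly_supported f := compact (closure [set x | f x != 0]).

Definition test_radial f := [/\ smooth f, radial f & compactly_supported f].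

Definition H1_norm f : \bar R :=
  ((\int[mu]_x (enorm (gradient f x) ^+ 2 + `|f x| ^+ 2)%:E) `^ 2^-1)%E.

(* Elements of the completion are given by Cauchy sequences; two of them
   denote the same element when the norm of their difference tends to 0. *)
Record H1r := MkH1r {
  H1r_seq :> nat -> 'rV[R]_N -> R ;
  H1r_seq_test : forall n, test_radial (H1r_seq n) ;
  H1r_seq_cauchy : forall e : R, 0 < e ->
    exists n0, forall m n, (n0 <= m)%N -> (n0 <= n)%N ->
      (H1_norm (H1r_seq m \- H1r_seq n)%R < e%:E)%E }.

Definition H1r_norm (h : H1r) : \bar R := limn (fun n => H1_norm (h n)).

(* The value of the weight at the origin is irrelevant, as powR 0 gamma is
   a real number and {0} is negligible. *)
Definition Lq_norm gamma q u : \bar R :=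
  ((\int[mu]_x (enorm x `^ gamma * `|u x| `^ q)%:E) `^ q^-1)%E.

Definition in_Lq gamma q u := measurable_fun setT u /\
  (\int[mu]_x (enorm x `^ gamma * `|u x| `^ q)%:E < +oo)%E.

(* The function (unique up to a.e. equality) denoted by an element of the
   completion: the limit in L^2, which the H^1 norm dominates. *)
Definition represents (h : H1r) u := in_Lq 0 2 u /\
  (fun n => Lq_norm 0 2 (h n \- u)) @ \oo --> 0%E.

End function_spaces.
Arguments H1r : clear implicits.

Definition crit_exp {R : realType} (N : nat) (gamma : R) : R :=
  2 * (N%:R + gamma) / (N%:R - 2).

Definition embedding (R : realType) (N : nat) (gamma q : R) :=
  exists C : R, forall (h : H1r R N) u, represents h u ->
    in_Lq gamma q u /\ (Lq_norm gamma q u <= C%:E * H1r_norm h)%E.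

(* Every bounded sequence has a subsequence that converges in the target. *)
Definition compact_embedding (R : realType) (N : nat) (gamma q : R) :=
  forall (h : nat -> H1r R N) (u : nat -> 'rV[R]_N -> R),
    (forall k, represents (h k) (u k)) ->
    (exists M : R, forall k, (H1r_norm (h k) <= M%:E)%E) ->
    exists (s : nat -> nat) (v : 'rV[R]_N -> R),
      [/\ {homo s : m n / (m < n)%N}, in_Lq gamma q v &
          (fun k => Lq_norm gamma q (u (s k) \- v)) @ \oo --> 0%E].

(* Main.v *)
(** Concentration at the origin.  Fix a smooth radial profile [phi] supported in
    the annulus [N - 1 <= |x|^2 <= 4 N + 1] and put
    [phi_l x = l^((N-2)/2) phi (l x)].  For [l >= 1] these functions are bounded
    in H^1, whereas the integral of [|x|^gamma |phi_l|^q] grows at least like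
    [l^((q - 2*(gamma)) (N-2)/2)]: this rules out any embedding above the
    critical exponent.  At the critical exponent the integral stays bounded
    below, and the functions with [l = 4^k] have pairwise disjoint supports, so
    no subsequence is Cauchy.  Both estimates only need the volume of boxes: a
    box containing the support of [phi_l] for the upper bound, the box
    [[1/l, 2/l]^N] for the lower one. *)

Require Import Defs.
From mathcomp Require Import all_boot all_order all_algebra.
From mathcomp Require Import all_classical all_reals all_analysis.
From mathcomp Require Import measurable_realfun ring lra.

Set Implicit Arguments.
Unset Strict Implicit.
Unset Printing Implicit Defensive.

Import Order.TTheory GRing.Theory Num.Theory.
Import numFieldNormedType.Exports.
Local Open Scope classical_set_scope.
Local Open Scope ring_scope.

(** * Flat functions: bounds and derivatives of [t^-k exp(-1/t)] extended by zero *)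

Section flat.
Context {R : realType}.
Implicit Types (t : R) (k : nat).

(* Successive derivatives of [exp (-1/t)] are combinations of the [flat k]. *)
Definition flat k t : R := if 0 < t then t^-1 ^+ k * expR (- t^-1) else 0.

Lemma flat_ge0 k t : 0 <= flat k t.
Proof.
by rewrite /flat; case: ifP => // t0; rewrite mulr_ge0 ?exprn_ge0 ?expR_ge0// invr_ge0 ltW.
Qed.

Lemma flat_le0 k t : t <= 0 -> flat k t = 0.
Proof. by rewrite /flat ltNge => ->. Qed.

(** With [s = 1/t], write [expR s] as the power [k.+1] of [E = expR (s / k.+1%:R)]. Since [E] is at
    least [1] and at least [s / k.+1%:R], this power dominates [(s / k.+1%:R) ^+ k]. *)
Lemma flat_bounded k : exists2 M : R, 0 < M & forall t, flat k t <= M.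
Proof.
exists (k.+1%:R ^+ k) => [|t]; first by rewrite exprn_gt0.
rewrite /flat; case: ifPn => [t0|_]; last exact: exprn_ge0.
set s := t^-1; have s0 : 0 <= s by rewrite invr_ge0 ltW.
rewrite expRN ler_pdivrMr ?expR_gt0//.
have -> : expR s = expR (s / k.+1%:R) ^+ k.+1.
  by rewrite -expRM_natl -mulrC divfK ?pnatr_eq0.
have s'0 : 0 <= s / k.+1%:R by rewrite divr_ge0.
have le1 : s / k.+1%:R <= expR (s / k.+1%:R).
  by apply: le_trans (expR_ge1Dx _); rewrite lerDr.
have ge1 : 1 <= expR (s / k.+1%:R).
  by apply: le_trans (expR_ge1Dx _); rewrite lerDl.
rewrite -[in leLHS](@divfK _ k.+1%:R _ s) ?pnatr_eq0// exprMn mulrC.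
rewrite ler_wpM2l ?exprn_ge0//.
apply: (@le_trans _ _ (expR (s / k.+1%:R) ^+ k)).
  by rewrite lerXn2r// nnegrE expR_ge0.
by rewrite exprS ler_peMl// exprn_ge0 ?expR_ge0.
Qed.

Lemma flat_ge_expN1 t : 1 <= t -> expR (- 1) <= flat 0 t.
Proof.
move=> t1; have t0 : 0 < t by exact: lt_le_trans t1.
by rewrite /flat t0 expr0 mul1r ler_expR lerN2 invf_le1.
Qed.

(** For [t > 0] this is the product and chain rule; for [t < 0] both sides vanish. Only [t = 0]
    needs an estimate. *)
Lemma is_derive_flat k t :
  is_derive t 1 (flat k) (- k%:R * flat k.+1 t + flat k.+2 t).
Proof.
have [t0|t0|->] := ltgtP t 0.
- rewrite !flat_le0 ?ltW// mulr0 addr0.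
  apply: (@near_eq_is_derive _ _ _ (cst 0)).
  by near=> s; rewrite /= flat_le0// ltW//; near: s; exact: lt_nbhsl.
- have tn0 : t != 0 by rewrite gt_eqF.
  have dV : is_derive t 1 (fun s : R => s^-1) (- t ^- 2 *: 1).
    exact: (@is_deriveV _ id _ _ _ tn0).
  have dN := is_deriveN dV.
  have dE := @is_derive1_comp _ expR (fun s => - s^-1) t _ _ (is_derive_expR _) dN.
  have dX := @is_deriveX R R (fun s : R => s^-1) k t 1 _ dV.
  have := @is_deriveM _ _ _ _ t 1 _ _ dX dE.
  have near_t : \near t, (((fun s : R => s^-1) ^+ k) *
      (expR \o (fun s => - s^-1))) t = flat k t.
    near=> s; rewrite /flat ifT; last by near: s; exact: lt_nbhsr.
    by rewrite mulrfctE exprfctE.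
  move/(near_eq_is_derive near_t) => dF.
  refine (eq_rect _ (is_derive t 1 (flat k)) dF _ _).
  rewrite /flat t0 /GRing.scale /= exprfctE -exprVn.
  by case: k {dX near_t dF} => [|k] /=; rewrite !exprS; ring.
- rewrite !flat_le0// mulr0 addr0.
  (* For [h > 0] the difference quotient at [0] equals [flat k.+2 h * h], so boundedness of
     [flat k.+2] squeezes it between [0] and [M * |h|]. *)
  have [M M0 fM] := flat_bounded k.+2.
  suff h0 : (fun h : R => h^-1 *: ((flat k \o shift 0) (h *: 1) - flat k 0))
      @ 0^' --> (0 : R).
    by apply: DeriveDef; [apply/cvg_ex; exists 0; exact: h0|exact: (cvg_lim _ h0)].
  rewrite -norm_cvg0P.
  apply: (@squeeze_cvgr _ _ _ _ (cst 0) (fun h => M * `|h|)); last 2 first.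
  + exact: cvg_cst.
  + rewrite -[X in _ --> X](mulr0 M); apply: cvgMr => //.
    by rewrite norm_cvg0P; exact: nbhs_dnbhs.
  near=> h; rewrite normr_ge0/= addr0 [_ *: 1]mulr1 (@flat_le0 _ 0)// subr0.
  have [h0|h0] := leP h 0.
    by rewrite flat_le0// scaler0 normr0 mulr_ge0 ?normr_ge0// ltW.
  have -> : h^-1 *: flat k h = flat k.+2 h * h.
    by rewrite /flat h0 /GRing.scale/= !exprS; field; rewrite gt_eqF.
  by rewrite normrM (ger0_norm (flat_ge0 _ _)) ler_wpM2r.
Unshelve. all: by end_near. Qed.

Lemma measurable_flat k : measurable_fun setT (flat k).
Proof.
apply: continuous_measurable_fun => t.
by apply/differentiable_continuous/derivable1_diffP; case: (is_derive_flat k t).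
Qed.

End flat.

(** * A class of smooth functions stable under partial derivatives *)

Section elementary.
Context {R : realType} {N : nat}.
Implicit Types (f g : 'rV[R]_N -> R) (x : 'rV[R]_N).

(* A class of smooth functions closed under partial derivatives and containing
   the test functions: smoothness follows by induction. *)
Inductive elementary : ('rV[R]_N -> R) -> Prop :=
| elementary_cst c : elementary (cst c)
| elementary_coord i : elementary (fun x => x ord0 i)
| elementaryD f g : elementary f -> elementary g ->
    elementary (fun x => f x + g x)
| elementaryM f g : elementary f -> elementary g ->
    elementary (fun x => f x * g x)
| elementary_flat k f : elementary f -> elementary (flat k \o f).

Lemma elementary_sum n (h : 'I_n -> 'rV[R]_N -> R) :
  (forall i, elementary (h i)) -> elementary (fun x => \sum_(i < n) h i x).
Proof.
elim: n h => [|n IHn] h eh.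
  by under eq_fun do rewrite big_ord0; exact: elementary_cst.
under eq_fun do rewrite big_ord_recl.
by apply: elementaryD => //; apply: IHn => i; exact: eh.
Qed.

Lemma elementary_differentiable f : elementary f -> forall x, differentiable f x.
Proof.
elim=> {f} [c x|i x|f g _ df _ dg x|f g _ df _ dg x|k f _ df x].
- exact: differentiable_cst.
- exact: differentiable_coord.
- exact: differentiableD.
- exact: differentiableM.
- apply: differentiable_comp => //; apply/derivable1_diffP.
  by case: (is_derive_flat k (f x)).
Qed.

Lemma elementary_is_derive f x v : elementary f ->
  is_derive x v f ('D_v f x).
Proof.
move=> ef; apply: derivableP; apply: diff_derivable.
exact: elementary_differentiable.
Qed.

(** Proved by induction instead of from continuity, because the sigma-algebra on row vectors is
    presented as generated by the coordinates. *)
Lemma measurable_elementary f : elementary f -> measurable_fun setT f.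
Proof.
elim=> {f} [c|i|f g _ mf _ mg|f g _ mf _ mg|k f _ mf].
- exact: measurable_cst.
- exact: measurable_rV_coord.
- exact: measurable_funD.
- exact: measurable_funM.
- by apply: measurableT_comp => //; exact: measurable_flat.
Qed.

Lemma partialD f g i : elementary f -> elementary g ->
  partial i (fun x => f x + g x) = fun x => partial i f x + partial i g x.
Proof.
move=> ef eg; apply/funext => x; rewrite /partial.
have := @deriveD _ _ _ f g x (delta_mx ord0 i); apply.
  by case: (elementary_is_derive x (delta_mx ord0 i) ef).
by case: (elementary_is_derive x (delta_mx ord0 i) eg).
Qed.

Lemma partialM f g i : elementary f -> elementary g ->
  partial i (fun x => f x * g x) =
  fun x => f x * partial i g x + g x * partial i f x.
Proof.
move=> ef eg; apply/funext => x; rewrite /partial.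
have := @deriveM _ _ f g x (delta_mx ord0 i); apply.
  by case: (elementary_is_derive x (delta_mx ord0 i) ef).
by case: (elementary_is_derive x (delta_mx ord0 i) eg).
Qed.

Lemma partial_cst (c : R) (i : 'I_N) : partial i (cst c) = cst 0.
Proof. by apply/funext => x; rewrite /partial derive_cst. Qed.

Lemma partial_coord i j :
  partial i (fun x : 'rV[R]_N => x ord0 j) = cst (j == i)%:R.
Proof.
apply/funext => x; rewrite /partial; apply: cvg_lim => //.
apply: (@cvg_trans _ (cst (j == i)%:R @ (0 : R)^')); last exact: cvg_cst.
apply: near_eq_cvg; near=> h => /=.
have h0 : h != 0 by near: h; exact: nbhs_dnbhs_neq.
by rewrite !mxE/= addrK /GRing.scale/= mulKf// eq_sym.
Unshelve. all: by end_near. Qed.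

Lemma partial_flat k f i : elementary f ->
  partial i (flat k \o f) =
  fun x => (- k%:R * flat k.+1 (f x) + flat k.+2 (f x)) * partial i f x.
Proof.
move=> ef; apply/funext => x; rewrite /partial.
have df := elementary_differentiable ef x.
have dk := is_derive_flat k (f x).
have dfk : differentiable (flat k) (f x).
  by apply/derivable1_diffP; case: dk.
rewrite !deriveE//; last exact: differentiable_comp.
rewrite diff_comp//= diff1E//= derive1E.
by rewrite (@derive_val _ _ _ _ _ _ _ dk) /GRing.scale/= mulrC.
Qed.

Lemma elementary_partial f i : elementary f -> elementary (partial i f).
Proof.
elim=> {f} [c|j|f g ef pf eg pg|f g ef pf eg pg|k f ef pf].
- by rewrite partial_cst; exact: elementary_cst.
- by rewrite partial_coord; exact: elementary_cst.
- by rewrite partialD//; exact: elementaryD.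
- rewrite partialM//; apply: elementaryD; exact: elementaryM.
- rewrite partial_flat//; apply: elementaryM => //.
  apply: elementaryD; last exact: (elementary_flat _ ef).
  apply: elementaryM; last exact: (elementary_flat _ ef).
  exact: elementary_cst.
Qed.

Lemma elementary_smooth f : elementary f -> smooth f.
Proof.
move=> ef s; have {}ef : elementary (foldr (@partial R N) f s).
  by elim: s => //= i s; exact: elementary_partial.
split=> [x|i x]; last exact/diff_derivable/elementary_differentiable.
exact/differentiable_continuous/elementary_differentiable.
Qed.

End elementary.

(** * Cubes: volume, compactness, and integral bounds over them *)

Section box.
Context {R : realType} {N : nat}.
Implicit Types (a b c : R) (g : 'rV[R]_N -> R).

Local Notation mu := (@lebesgue_rV R N).

Definition box a b : set 'rV[R]_N := [set x | forall i, `[a, b]%classic (x ord0 i)].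

Lemma measurable_box a b : measurable (box a b).
Proof.
rewrite (_ : box a b = \big[setI/setT]_(i < N) (rV_coord i @^-1` `[a, b])).
  apply: bigsetI_measurable => i _; rewrite -[X in measurable X]setTI.
  exact: measurable_rV_coord.
rewrite -bigcap_seq; apply/seteqP; split => x /= h i; first by move=> _; exact: h.
exact: (h i (mem_index_enum i)).
Qed.

Lemma lebesgue_box a b : a <= b -> mu (box a b) = ((b - a) ^+ N)%:E.
Proof.
move=> ab; rewrite (@lebesgue_rV_box R N (fun=> `[a, b]%classic)); last first.
  by move=> i; exact: measurable_itv.
under eq_bigr do rewrite lebesgue_measure_itv/= lte_fin.
rewrite (eq_bigr (fun=> (b - a)%:E)) => [|i _].
  by rewrite prodEFin prodr_const card_ord.
(* The measure of the interval is a conditional on [a < b]; this settles the degenerate case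
   [a = b]. *)
have [//|ba] := ltP a b; have /eqP -> : a == b by rewrite eq_le ab.
by rewrite subrr.
Qed.

Lemma compact_box a b : compact (box a b).
Proof. by apply: (@rV_compact R N (fun=> `[a, b]%classic)) => i; exact: segment_compact. Qed.

Lemma closed_box a b : closed (box a b).
Proof. by apply: compact_closed; [exact: norm_hausdorff|exact: compact_box]. Qed.

(** Together with the lower bound below, this takes the place of polar coordinates and of the change
    of variables [x -> l x]: a pointwise bound times the volume of a cube already has the right
    power of [l]. *)
Lemma integral_le_box g a b c : measurable_fun setT g ->
  (forall x, 0 <= g x) -> (forall x, box a b x -> g x <= c) ->
  (forall x, ~ box a b x -> g x = 0) -> a <= b ->
  (\int[mu]_x (g x)%:E <= (c * (b - a) ^+ N)%:E)%E.
Proof.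
move=> mg g0 gc gN ab; have mB := measurable_box a b.
rewrite EFinM -lebesgue_box// -integral_cst//.
rewrite (_ : \int[mu]_x _ = \int[mu]_(x in box a b) (g x)%:E)%E; last first.
  rewrite [RHS]integral_mkcond; apply: eq_integral => x _.
  by rewrite patchE; case: ifPn => //; rewrite notin_setE => /gN ->.
apply: ge0_le_integral => //.
- by move=> x _; rewrite lee_fin.
- by apply/measurable_EFinP; exact: measurable_funTS.
Qed.

Lemma box_le_integral g a b c : measurable_fun setT g ->
  (forall x, 0 <= g x) -> (forall x, box a b x -> c <= g x) ->
  0 <= c -> a <= b ->
  ((c * (b - a) ^+ N)%:E <= \int[mu]_x (g x)%:E)%E.
Proof.
move=> mg g0 gc c0 ab; have mB := measurable_box a b.
rewrite EFinM -lebesgue_box// -integral_cst//.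
apply: (@le_trans _ _ (\int[mu]_(x in box a b) (g x)%:E)%E).
  apply: ge0_le_integral => //.
  - by apply/measurable_EFinP; exact: measurable_funTS.
apply: ge0_subset_integral => //; first exact/measurable_EFinP.
by move=> x _; rewrite lee_fin.
Qed.

End box.

(** * Norms of elementary functions, and test functions as elements of the completion *)

Section norms.
Context {R : realType} {N : nat}.
Implicit Types (f g : 'rV[R]_N -> R) (x : 'rV[R]_N).

Local Notation mu := (@lebesgue_rV R N).

Definition sqnorm x : R := \sum_(i < N) x ord0 i ^+ 2.

Lemma sqnorm_ge0 x : 0 <= sqnorm x.
Proof. by apply: sumr_ge0 => i _; exact: sqr_ge0. Qed.

Lemma sqr_enorm x : enorm x ^+ 2 = sqnorm x.
Proof. by rewrite sqr_sqrtr// sqnorm_ge0. Qed.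

Lemma sqr_coord_le_sqnorm x i : x ord0 i ^+ 2 <= sqnorm x.
Proof.
rewrite /sqnorm (bigD1 i)//= lerDl.
by apply: sumr_ge0 => j _; exact: sqr_ge0.
Qed.

Lemma elementary_sqnorm : elementary sqnorm.
Proof. by apply: elementary_sum => i; apply: elementaryM; exact: elementary_coord. Qed.

Lemma partial_sum n (h : 'I_n -> 'rV[R]_N -> R) i :
  (forall j, elementary (h j)) ->
  partial i (fun x => \sum_(j < n) h j x) = fun x => \sum_(j < n) partial i (h j) x.
Proof.
elim: n h => [|n IHn] h eh.
  rewrite (_ : (fun=> _) = cst 0); last by apply/funext => x; rewrite big_ord0.
  by rewrite partial_cst; apply/funext => x; rewrite big_ord0.
under eq_fun do rewrite big_ord_recl.
rewrite partialD//; last by apply: elementary_sum => j; exact: eh.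
by apply/funext => x; rewrite IHn// big_ord_recl.
Qed.

Lemma partial_sqnorm i : partial i sqnorm = fun x => 2 * x ord0 i.
Proof.
rewrite partial_sum => [|j]; last by apply: elementaryM; exact: elementary_coord.
apply/funext => x.
rewrite (eq_bigr (fun j => 2 * x ord0 j * (j == i)%:R)) => [|j _]; last first.
  rewrite (@partialM _ _ (fun x => x ord0 j) (fun x => x ord0 j)) ?partial_coord/=.
  - by ring.
  - exact: elementary_coord.
  - exact: elementary_coord.
rewrite (bigD1 i)//= eqxx mulr1 big1 ?addr0// => j /negbTE ->.
by rewrite mulr0.
Qed.

Lemma measurable_enorm : measurable_fun setT (@enorm R N).
Proof.
have msqrt : measurable_fun setT (fun t : R => Num.sqrt t).
  by apply: continuous_measurable_fun; exact: sqrt_continuous.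
exact: (measurableT_comp msqrt (measurable_elementary elementary_sqnorm)).
Qed.

Lemma measurable_weighted gamma q f : measurable_fun setT f ->
  measurable_fun setT (fun x => enorm x `^ gamma * `|f x| `^ q).
Proof.
move=> mf; apply: measurable_funM.
  by apply: (measurableT_comp (measurable_powR _)); exact: measurable_enorm.
by apply: (measurableT_comp (measurable_powR _)); exact: measurableT_comp.
Qed.

(** The integrand of the squared H^1 norm, free of square roots and absolute values so that it stays
    elementary, hence measurable. *)
Definition energy f x : R := \sum_(i < N) partial i f x ^+ 2 + f x ^+ 2.

Lemma elementary_energy f : elementary f -> elementary (energy f).
Proof.
move=> ef; apply: elementaryD; last exact: elementaryM.
by apply: elementary_sum => i; apply: elementaryM; exact: elementary_partial.
Qed.

Lemma H1_normE f : H1_norm f = ((\int[mu]_x (energy f x)%:E) `^ 2^-1)%E.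
Proof.
rewrite /H1_norm; congr poweR; apply: eq_integral => x _.
rewrite sqr_enorm /sqnorm /energy real_normK ?num_real//; congr (_ + _)%:E.
by apply: eq_bigr => i _; rewrite mxE.
Qed.

Lemma H1_norm_subrr f : H1_norm (f \- f) = 0%E.
Proof.
rewrite (_ : _ \- _ = cst 0); last by apply/funext => x /=; rewrite subrr.
rewrite H1_normE integral0_eq ?poweR0r ?invr_eq0// => x _; congr (_%:E).
by rewrite /energy big1 => [|i _]; rewrite ?partial_cst expr0n ?addr0.
Qed.

(** The constant sequence is the canonical image of a test function in the completion. The
    definition is transparent so that its terms reduce to [f]. *)
Definition H1r_of_test f (tf : test_radial f) : H1r R N.
Proof.
refine (@MkH1r R N (fun=> f) (fun=> tf) _) => e e0; exists 0%N => m n _ _.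
by rewrite H1_norm_subrr lte_fin.
Defined.

Lemma H1r_norm_of_test f (tf : test_radial f) : H1r_norm (H1r_of_test tf) = H1_norm f.
Proof.
have c : (fun n => H1_norm (H1r_of_test tf n)) @ \oo --> H1_norm f.
  exact: (@cvg_cst (\bar R) (H1_norm f) nat \oo _).
exact: (cvg_lim _ c).
Qed.

Lemma represents_of_test f (tf : test_radial f) :
  in_Lq 0 2 f -> represents (H1r_of_test tf) f.
Proof.
move=> Lf; split=> //=; rewrite (_ : (fun=> _) = cst 0%E); first exact: (@cvg_cst (\bar R)).
apply/funext => n; rewrite /Lq_norm integral0_eq ?poweR0r ?invr_eq0// => x _.
by rewrite /= subrr normr0 powR0// mulr0.
Qed.

Lemma box_compactly_supported f a b : (forall x, ~ box a b x -> f x = 0) ->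
  compactly_supported f.
Proof.
move=> fN; apply: (subclosed_compact _ (@compact_box R N a b)).
  exact: closed_closure.
rewrite ((closure_id (box a b)).1 (@closed_box _ _ a b)).
apply: closureS => x /= fx; apply: contrapT => /fN fx0.
by rewrite fx0 eqxx in fx.
Qed.

End norms.

(** * The rescaled radial profiles: support, bounded H^1 norm, weighted lower bound *)

Section bump.
Context {R : realType} (N : nat).
Implicit Types (l t : R) (x : 'rV[R]_N).

Local Notation mu := (@lebesgue_rV R N).
Local Notation K := (4 * N%:R + 1 : R).

(* On the box [[1/l, 2/l]^N], [l^2 |x|^2] lies in [[N, 4N]], where both factors
   have argument at least 1. *)
Definition bump l x : R := l `^ ((N%:R - 2) / 2) *
  (flat 0 (l ^+ 2 * sqnorm x + (1 - N%:R)) * flat 0 (K + - l ^+ 2 * sqnorm x)).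

Let elementary_in l : elementary (fun x => l ^+ 2 * sqnorm x + (1 - N%:R)).
Proof.
apply: elementaryD (elementary_cst _).
exact: elementaryM (elementary_cst _) elementary_sqnorm.
Qed.

Let elementary_out l : elementary (fun x => K + - l ^+ 2 * sqnorm x).
Proof.
apply: elementaryD (elementary_cst _) _.
exact: elementaryM (elementary_cst _) elementary_sqnorm.
Qed.

Lemma elementary_bump l : elementary (bump l).
Proof.
apply: elementaryM (elementary_cst _) _.
by apply: elementaryM; apply: (elementary_flat 0).
Qed.

(** The derivative of [flat 0] is [flat 2], as the coefficient of [flat 1] is zero; the two factors
    contribute with opposite signs because their arguments have opposite gradients. *)
Lemma partial_bump l i : partial i (bump l) = fun x =>
  l `^ ((N%:R - 2) / 2) * (2 * l ^+ 2 * x ord0 i) *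
  (flat 2 (l ^+ 2 * sqnorm x + (1 - N%:R)) * flat 0 (K + - l ^+ 2 * sqnorm x)
   - flat 0 (l ^+ 2 * sqnorm x + (1 - N%:R)) * flat 2 (K + - l ^+ 2 * sqnorm x)).
Proof.
have ein := elementary_in l; have eout := elementary_out l.
have es := @elementary_sqnorm R N.
have ec c := @elementary_cst R N c.
have fin := elementary_flat 0 ein; have fout := elementary_flat 0 eout.
have pin : partial i (fun x => l ^+ 2 * sqnorm x + (1 - N%:R)) =
    fun x => 2 * l ^+ 2 * x ord0 i.
  rewrite (partialD i (elementaryM (ec (l ^+ 2)) es) (ec (1 - N%:R))).
  rewrite (partialM i (ec (l ^+ 2)) es) !partial_cst partial_sqnorm.
  by apply/funext => x /=; ring.
have pout : partial i (fun x => K + - l ^+ 2 * sqnorm x) =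
    fun x => - (2 * l ^+ 2 * x ord0 i).
  rewrite (partialD i (ec K) (elementaryM (ec (- l ^+ 2)) es)).
  rewrite (partialM i (ec (- l ^+ 2)) es) !partial_cst partial_sqnorm.
  by apply/funext => x /=; ring.
rewrite /bump (partialM i (ec (l `^ _)) (elementaryM fin fout)).
rewrite (partialM i fin fout) (partial_flat 0 i ein) (partial_flat 0 i eout).
rewrite pin pout partial_cst; apply/funext => x /=.
by rewrite oppr0 !mul0r; ring.
Qed.

Lemma bump_ge0 l x : 0 <= bump l x.
Proof. by rewrite mulr_ge0 ?powR_ge0// mulr_ge0// flat_ge0. Qed.

Lemma bump_out l x : K <= l ^+ 2 * sqnorm x -> bump l x = 0.
Proof.
by move=> h; rewrite /bump (@flat_le0 _ _ (K + _)) ?mulr0// mulNr subr_le0.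
Qed.

Lemma bump_in l x : l ^+ 2 * sqnorm x <= N%:R - 1 -> bump l x = 0.
Proof.
move=> h; rewrite /bump (@flat_le0 _ _ (_ + (1 - _))) ?mul0r ?mulr0//.
by rewrite -opprB subr_le0.
Qed.

Let K_ge1 : 1 <= K. Proof. by rewrite lerDr mulr_ge0. Qed.

(** Some coordinate satisfies [l |x_i| > K], so the right-hand side is at least [K ^+ 2], which
    exceeds or equals [K] because [1 <= K]. *)
Let out_box l x : 0 < l -> ~ box (- (K / l)) (K / l) x -> K <= l ^+ 2 * sqnorm x.
Proof.
move=> l0 /existsNP[i]; rewrite /= in_itv/= -ler_norml => /negP.
rewrite -ltNge => ltx; apply: (@le_trans _ _ (l ^+ 2 * x ord0 i ^+ 2)); last first.
  by rewrite ler_wpM2l ?sqr_ge0// sqr_coord_le_sqnorm.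
apply: (@le_trans _ _ (K ^+ 2)); first by rewrite expr2 ler_peMl// (le_trans _ K_ge1).
rewrite -exprMn -[leRHS]real_normK ?num_real//.
apply: lerXn2r; rewrite ?nnegrE//.
by rewrite normrM (gtr0_norm l0) [l * _]mulrC -ler_pdivrMr// ltW.
Qed.

Lemma energy_bump_out l x : K <= l ^+ 2 * sqnorm x -> energy (bump l) x = 0.
Proof.
move=> h; have h' : K + - l ^+ 2 * sqnorm x <= 0 by rewrite mulNr subr_le0.
rewrite /energy bump_out// big1 ?expr0n ?addr0// => i _.
by rewrite partial_bump /= !(flat_le0 _ h') !mulr0 subr0 mulr0 expr0n.
Qed.

Lemma bump_support l x : 0 < l -> ~ box (- (K / l)) (K / l) x -> bump l x = 0.
Proof. by move=> l0 /(out_box l0); exact: bump_out. Qed.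

Lemma test_radial_bump l : 0 < l -> test_radial (bump l).
Proof.
move=> l0; split.
- exact: elementary_smooth (elementary_bump l).
- by move=> x y exy; rewrite /bump -!sqr_enorm exy.
- by apply: box_compactly_supported => x; exact: bump_support.
Qed.

(** This is what fixes the exponent [(N - 2) / 2]: a derivative costs a factor [l], so the squared
    gradient has size [l ^+ N], which cancels the volume of a cube of side proportional to
    [1 / l]. *)
Let scale_sqr l : 0 < l -> (l `^ ((N%:R - 2) / 2)) ^+ 2 * l ^+ 2 = l ^+ N.
Proof.
move=> l0; rewrite -!powR_mulrn ?powR_ge0 ?ltW// -powRrM -powRD; last first.
  by rewrite (gt_eqF l0) implybT.
by congr powR; field.
Qed.

Lemma H1_norm_bump_bounded :
  exists B : R, forall l, 1 <= l -> (H1_norm (bump l) <= B%:E)%E.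
Proof.
have [M0 M00 f0] := @flat_bounded R 0; have [M2 M20 f2] := @flat_bounded R 2.
pose M := M0 + M2.
have M_ge0 : 0 <= M by rewrite addr_ge0 ?ltW.
have f0M t : flat 0 t <= M by rewrite (le_trans (f0 _))// lerDl ltW.
have f2M t : flat 2 t <= M by rewrite (le_trans (f2 _))// lerDr ltW.
(* [D] bounds the energy after division by [l ^+ N]: one equal term for each of the [N] partial
   derivatives, and one for the function itself. *)
pose D := N%:R * (2 * K * M ^+ 2) ^+ 2 + (M ^+ 2) ^+ 2.
exists ((D * (2 * K) ^+ N) `^ 2^-1) => l l1.
have l0 : 0 < l by exact: lt_le_trans l1.
have K0 : 0 <= K by rewrite (le_trans _ K_ge1).
have Kl0 : 0 <= K / l by rewrite divr_ge0// ltW.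
rewrite H1_normE -poweR_EFin; apply: gt0_ler_poweR; rewrite ?invr_ge0//.
- rewrite in_itv/= leey andbT; apply: integral_ge0 => x _; rewrite lee_fin.
  by rewrite addr_ge0 ?sqr_ge0// sumr_ge0// => i _; exact: sqr_ge0.
- rewrite in_itv/= leey andbT lee_fin mulr_ge0 ?exprn_ge0 ?mulr_ge0//.
  by rewrite addr_ge0 ?mulr_ge0 ?sqr_ge0.
(* The bound is split into a pointwise bound and the volume of the cube containing the support. *)
rewrite (_ : D * _ = (l ^+ N * D) * (K / l - - (K / l)) ^+ N); last first.
  rewrite opprK (_ : K / l + K / l = 2 * K / l); last by field; rewrite gt_eqF.
  by rewrite expr_div_n; field; rewrite expf_neq0// gt_eqF.
apply: integral_le_box.
- exact: (measurable_elementary (elementary_energy (elementary_bump l))).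
- by move=> x; rewrite addr_ge0 ?sqr_ge0// sumr_ge0// => i _; exact: sqr_ge0.
- move=> x Bx; rewrite -scale_sqr//.
  set A := l `^ _; have A0 : 0 <= A by exact: powR_ge0.
  have sqr_le (a b : R) : `|a| <= b -> a ^+ 2 <= b ^+ 2.
    by move=> ab; rewrite -[leLHS]real_normK ?num_real// lerXn2r// nnegrE ?(le_trans _ ab).
  have -> : A ^+ 2 * l ^+ 2 * D =
      \sum_(i < N) (A * (2 * l * K) * M ^+ 2) ^+ 2 + (A * l * M ^+ 2) ^+ 2.
    by rewrite sumr_const card_ord -mulr_natl /D; ring.
  rewrite /energy; apply: lerD.
    apply: ler_sum => i _; apply: sqr_le; rewrite partial_bump -/A normrM.
    apply: ler_pM => //.
      (* On the cube [|x_i| <= K / l], which turns the factor [2 * l ^+ 2 * x_i] into at most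
         [2 * l * K]. *)
      rewrite normrM (ger0_norm A0) ler_wpM2l// normrM normrM (ger0_norm (ler0n R 2)).
      rewrite (ger0_norm (sqr_ge0 l)) -!mulrA ler_wpM2l//.
      rewrite ler_wpM2l ?(ltW l0)// -ler_pdivlMl// [l^-1 * _]mulrC ler_norml.
      by have := Bx i; rewrite /= in_itv.
    set a := flat 2 _ * _; set b := flat 0 _ * _.
    have a0 : 0 <= a by rewrite mulr_ge0 ?flat_ge0.
    have b0 : 0 <= b by rewrite mulr_ge0 ?flat_ge0.
    have aM : a <= M ^+ 2 by rewrite expr2 ler_pM ?flat_ge0.
    have bM : b <= M ^+ 2 by rewrite expr2 ler_pM ?flat_ge0.
    by rewrite ler_norml; apply/andP; split; lra.
  apply: sqr_le; rewrite ger0_norm ?bump_ge0// -mulrA ler_wpM2l//.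
  apply: (@le_trans _ _ (M ^+ 2)); first by rewrite expr2 ler_pM ?flat_ge0.
  (* The function itself carries no factor [l] from differentiation; [1 <= l] supplies it. *)
  by rewrite ler_peMl ?sqr_ge0.
- by move=> x /(out_box l0); exact: energy_bump_out.
- by rewrite ge0_cp.
Qed.

Lemma bump_in_L2 l : 0 < l -> in_Lq 0 2 (bump l).
Proof.
move=> l0; have [M M0 fM] := @flat_bounded R 0.
have mb := measurable_elementary (elementary_bump l).
have Kl0 : 0 <= K / l by rewrite divr_ge0 ?(ltW l0)// (le_trans _ K_ge1).
split=> //; apply: (@le_lt_trans _ _
    (((l `^ ((N%:R - 2) / 2) * (M * M)) `^ 2) * (K / l - - (K / l)) ^+ N)%:E).
  apply: integral_le_box.
  - exact: measurable_weighted.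
  - by move=> x; rewrite mulr_ge0 ?powR_ge0.
  - move=> x _; rewrite powRr0 mul1r ge0_ler_powR ?nnegrE// ?ger0_norm ?bump_ge0//.
      by rewrite mulr_ge0 ?powR_ge0// mulr_ge0 ?ltW.
    by rewrite ler_wpM2l ?powR_ge0// ler_pM ?flat_ge0.
  - by move=> x /(bump_support l0) ->; rewrite normr0 powR0// mulr0.
  - by rewrite ge0_cp.
by rewrite ltry.
Qed.

Lemma weighted_bump_lower_bound l (gamma q : R) : (0 < N)%N -> 0 < l -> -2 <= gamma ->
  0 <= q ->
  (((expR (- 1) ^+ 2) `^ q / (4 * N%:R) *
      l `^ (q * ((N%:R - 2) / 2) - gamma - N%:R))%:E <=
   \int[mu]_x (enorm x `^ gamma * `|bump l x| `^ q)%:E)%E.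
Proof.
move=> N0 l0 hg q0; set A := l `^ ((N%:R - 2) / 2).
have NR : 1 <= N%:R :> R by rewrite ler1n.
have mb := measurable_elementary (elementary_bump l).
(* The constant is regrouped as a lower bound for the weight, one for the power of the bump, and the
   volume of the cube with sides [[1/l, 2/l]]. *)
have -> : (expR (- 1) ^+ 2) `^ q / (4 * N%:R) *
      l `^ (q * ((N%:R - 2) / 2) - gamma - N%:R) =
    ((4 * N%:R)^-1 * l `^ (- gamma)) * (A * expR (- 1) ^+ 2) `^ q *
    (2 / l - 1 / l) ^+ N.
  rewrite powRM ?powR_ge0 ?sqr_ge0// -powRrM -mulrBl (_ : 2 - 1 = 1 :> R); last by lra.
  rewrite mul1r exprVn -(powR_mulrn N (ltW l0)) -powRN !powRD ?(gt_eqF l0) ?implybT//.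
  by rewrite (mulrC q); ring.
apply: box_le_integral.
- exact: measurable_weighted.
- by move=> x; rewrite mulr_ge0 ?powR_ge0.
- move=> x Bx.
  have lx i : 1 <= l * x ord0 i <= 2.
    have /= := Bx i; rewrite in_itv/= => /andP[].
    by rewrite ler_pdivrMr// ler_pdivlMr// mulrC => -> ->.
  have s1 : N%:R <= l ^+ 2 * sqnorm x.
    rewrite /sqnorm mulr_sumr -[N in N%:R]card_ord -sumr_const.
    apply: ler_sum => i _; rewrite -exprMn; have /andP[h _] := lx i.
    rewrite -(expr1n _ 2); apply: lerXn2r; rewrite ?nnegrE//.
    exact: le_trans h.
  have s2 : l ^+ 2 * sqnorm x <= 4 * N%:R.
    rewrite /sqnorm mulr_sumr mulr_natr -[N in _ *+ N]card_ord -sumr_const.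
    apply: ler_sum => i _; rewrite -exprMn; have /andP[h h2] := lx i.
    rewrite (_ : 4 = 2 ^+ 2); last by rewrite expr2; lra.
    by apply: lerXn2r; rewrite ?nnegrE//; exact: le_trans h.
  have e0 : 0 <= enorm x by exact: sqrtr_ge0.
  have le0 : 0 <= l * enorm x by rewrite mulr_ge0// ltW.
  have sle : (l * enorm x) ^+ 2 = l ^+ 2 * sqnorm x by rewrite exprMn sqr_enorm.
  have le1 : 1 <= l * enorm x.
    by rewrite -(@ler_pXn2r _ 2)// ?nnegrE// expr1n sle (le_trans NR).
  apply: ler_pM; rewrite ?mulr_ge0 ?powR_ge0 ?invr_ge0 ?mulr_ge0//.
    have -> : enorm x `^ gamma = (l * enorm x) `^ gamma * l `^ (- gamma).
      rewrite powRM ?(ltW l0)// powRN; field.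
      by rewrite powR_eq0 gt_eqF.
    (* As [l |x| >= 1] and [gamma >= -2], the power [gamma] of [l |x|] is at least its power [-2],
       which is at least [1 / (4 N)]. This makes the constant independent of [gamma]. *)
    rewrite ler_wpM2r ?powR_ge0//; apply: (@le_trans _ _ ((l * enorm x) `^ (-2))).
      have s0 : 0 < l ^+ 2 * sqnorm x by apply: lt_le_trans s1; rewrite ltr0n.
      by rewrite powRN powR_mulrn// sle lef_pV2// posrE (lt_le_trans s0).
    by rewrite ler_powR.
  apply: ge0_ler_powR; rewrite ?nnegrE ?mulr_ge0 ?powR_ge0 ?sqr_ge0//.
  rewrite ger0_norm ?bump_ge0// ler_wpM2l ?powR_ge0// expr2.
  rewrite ler_pM ?expR_ge0// flat_ge_expN1//; lra.
- by rewrite !mulr_ge0 ?powR_ge0// invr_ge0 mulr_ge0.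
- by rewrite ler_wpM2r ?invr_ge0 ?(ltW l0)//; lra.
Qed.

End bump.

(** * Separation in the weighted space of functions with disjoint supports *)

Section separation.
Context {R : realType} {N : nat}.
Implicit Types (u v : 'rV[R]_N -> R) (gamma q : R).

Local Notation mu := (@lebesgue_rV R N).

(** The sum is at most twice the larger term. The constant is not sharp, but no convexity is
    involved. *)
Lemma powRD_le (a b q : R) : 0 <= a -> 0 <= b -> 0 <= q ->
  (a + b) `^ q <= 2 `^ q * (a `^ q + b `^ q).
Proof.
move=> a0 b0 q0; wlog ab : a b a0 b0 / a <= b => [h|].
  have [/h|/ltW/h] := leP a b; first exact.
  by rewrite addrC [X in _ * X]addrC; exact.
apply: (@le_trans _ _ ((2 * b) `^ q)).
  by apply: ge0_ler_powR; rewrite ?nnegrE ?addr_ge0 ?mulr_ge0//; lra.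
by rewrite powRM// ler_wpM2l ?powR_ge0// lerDr powR_ge0.
Qed.

(** Where [u1] is nonzero, [u2] vanishes, so [|u1| <= |u1 - v| + |v| = |u1 - v| + |u2 - v|]. Hence
    two functions with disjoint supports cannot both be close to [v] unless the first is small. *)
Lemma integral_le_of_disjoint gamma q u1 u2 v : 0 <= q ->
  measurable_fun setT u1 -> measurable_fun setT u2 -> measurable_fun setT v ->
  (forall x, u1 x = 0 \/ u2 x = 0) ->
  (\int[mu]_x (enorm x `^ gamma * `|u1 x| `^ q)%:E <=
   (2 `^ q)%:E * (\int[mu]_x (enorm x `^ gamma * `|(u1 \- v) x| `^ q)%:E +
                 \int[mu]_x (enorm x `^ gamma * `|(u2 \- v) x| `^ q)%:E))%E.
Proof.
move=> q0 mu1 mu2 mv u12.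
have m1 := measurable_weighted gamma q (measurable_funB mu1 mv).
have m2 := measurable_weighted gamma q (measurable_funB mu2 mv).
have w0 (w : 'rV[R]_N -> R) x : 0 <= enorm x `^ gamma * `|w x| `^ q.
  by rewrite mulr_ge0 ?powR_ge0.
rewrite -ge0_integralD//; last 4 first.
- by move=> x _; rewrite lee_fin w0.
- exact/measurable_EFinP.
- by move=> x _; rewrite lee_fin w0.
- exact/measurable_EFinP.
rewrite -ge0_integralZl_EFin ?powR_ge0//; last 2 first.
- by move=> x _; rewrite -EFinD lee_fin addr_ge0 ?w0.
- by apply/measurable_EFinP; exact: measurable_funD.
apply: ge0_le_integral => //.
- by move=> x _; rewrite lee_fin w0.
- by apply/measurable_EFinP; exact: measurable_weighted.
- apply/measurable_EFinP; apply: measurable_funM => //.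
  exact: measurable_funD.
move=> x _; rewrite -EFinD -EFinM lee_fin -mulrDr mulrCA.
rewrite ler_wpM2l ?powR_ge0//; apply: le_trans (powRD_le _ _ q0) => //.
apply: ge0_ler_powR; rewrite ?nnegrE//.
have [->|u2x] := u12 x; first by rewrite normr0.
rewrite /= u2x sub0r normrN; have := ler_normD (u1 x - v x) (v x).
by rewrite subrK.
Qed.

Lemma integral_weightedE gamma q u : q != 0 ->
  (\int[mu]_x (enorm x `^ gamma * `|u x| `^ q)%:E = Lq_norm gamma q u `^ q)%E.
Proof.
move=> q0; rewrite /Lq_norm -poweRrM mulVf// poweRe1//.
by apply: integral_ge0 => x _; rewrite lee_fin mulr_ge0 ?powR_ge0.
Qed.

Lemma integral_weighted_le gamma q u (c : R) : 0 < q ->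
  (Lq_norm gamma q u <= c%:E)%E ->
  (\int[mu]_x (enorm x `^ gamma * `|u x| `^ q)%:E <= (c `^ q)%:E)%E.
Proof.
move=> q0 uc; rewrite integral_weightedE ?gt_eqF// -poweR_EFin.
have u0 : (0 <= Lq_norm gamma q u)%E by exact: poweR_ge0.
apply: gt0_ler_poweR => //; first exact: ltW.
- by rewrite in_itv/= u0 leey.
- by rewrite in_itv/= (le_trans u0 uc) leey.
Qed.

End separation.

(** If [l^2 |x|^2 > N - 1], then [l'^2 |x|^2] is at least [16 (N - 1)], which is beyond the outer
    radius [4 N + 1] once [N >= 2]. *)
Lemma bump_disjoint {R : realType} (N : nat) (l l' : R) (x : 'rV[R]_N) :
  (1 < N)%N -> 0 < l -> 4 * l <= l' -> bump l x = 0 \/ bump l' x = 0.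
Proof.
move=> N1 l0 ll'; have NR : 2 <= N%:R :> R by rewrite (ler_nat _ 2).
have [h|h] := leP (l ^+ 2 * sqnorm x) (N%:R - 1); first by left; exact: bump_in.
right; apply: bump_out; apply: (@le_trans _ _ (16 * (l ^+ 2 * sqnorm x))).
  by lra.
rewrite mulrA ler_wpM2r ?sqnorm_ge0// (_ : 16 = 4 ^+ 2 :> R); last first.
  by rewrite expr2; lra.
have l40 : 0 <= 4 * l by rewrite mulr_ge0// ltW.
by rewrite -exprMn; apply: lerXn2r; rewrite ?nnegrE// (le_trans _ ll').
Qed.

(** * Failure of the embedding above the critical exponent, and of compactness at it *)

Section critical_exponent.
Context {R : realType} {N : nat} {gamma : R}.
Hypotheses (hN : (3 <= N)%N) (hgamma : -2 <= gamma).

Let NR : 3 <= N%:R :> R. Proof. by rewrite (ler_nat _ 3). Qed.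

Lemma crit_exp_gt0 : 0 < crit_exp N gamma.
Proof. by rewrite /crit_exp divr_gt0 ?mulr_gt0//; move: NR hgamma; lra. Qed.

(** The power of [l] in the lower bound for [bump l] thus has the sign of [q - crit_exp N gamma]. *)
Lemma crit_exp_scaling (q : R) :
  q * ((N%:R - 2) / 2) - gamma - N%:R = (q - crit_exp N gamma) * ((N%:R - 2) / 2).
Proof.
by rewrite /crit_exp; field; rewrite ?subr_eq0 gt_eqF//; move: NR; lra.
Qed.

Let c0 (q : R) : R := (expR (- 1) ^+ 2) `^ q / (4 * N%:R).

Let c0_gt0 q : 0 < c0 q.
Proof.
rewrite divr_gt0 ?powR_gt0 ?exprn_gt0 ?expR_gt0//.
by rewrite mulr_gt0//; move: NR; lra.
Qed.

Let bump_represents (l : R) (l0 : 0 < l) :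
  represents (H1r_of_test (test_radial_bump N l0)) (bump l).
Proof. exact/represents_of_test/bump_in_L2. Qed.

Let bump_lower (l q : R) : 0 < l -> 0 <= q ->
  ((c0 q * l `^ ((q - crit_exp N gamma) * ((N%:R - 2) / 2)))%:E <=
   \int[@lebesgue_rV R N]_x (enorm x `^ gamma * `|bump l x| `^ q)%:E)%E.
Proof.
move=> l0 q0; rewrite -crit_exp_scaling.
by apply: weighted_bump_lower_bound => //; exact: leq_trans hN.
Qed.

Lemma no_embedding (q : R) : crit_exp N gamma < q -> ~ embedding N gamma q.
Proof.
move=> hq [C hC]; have q0 : 0 < q by exact: lt_trans crit_exp_gt0 hq.
have [B hB] := @H1_norm_bump_bounded R N.
set e := (q - crit_exp N gamma) * ((N%:R - 2) / 2) : R.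
have e0 : 0 < e.
  by rewrite mulr_gt0 ?subr_gt0// divr_gt0//; move: NR; lra.
(* Absolute values are taken because [C] and [B] come without a sign. *)
pose D : R := `|C| * `|B|.
have D0 : 0 <= D `^ q / c0 q by rewrite divr_ge0 ?powR_ge0// ltW.
have t0 : 0 < D `^ q / c0 q + 1 by rewrite ltr_wpDl.
(* With this [l], the lower bound [c0 q * l^e] equals [D^q + c0 q], strictly above the bound [D^q]
   that an embedding would impose. *)
pose l := (D `^ q / c0 q + 1) `^ e^-1.
have l1 : 1 <= l.
  have one : (1 : R) `^ e^-1 = 1 by rewrite powR1.
  rewrite -[leLHS]one; apply: ge0_ler_powR; rewrite ?nnegrE ?invr_ge0 ?(ltW e0) ?(ltW t0)//.
  by rewrite lerDr.
have l0 : 0 < l by exact: lt_le_trans l1.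
have [_ hl] := hC _ _ (bump_represents l0).
have hD : (Lq_norm gamma q (@bump R N l) <= D%:E)%E.
  apply: (le_trans hl); rewrite H1r_norm_of_test /D EFinM.
  have H0 : (0 <= H1_norm (@bump R N l))%E by exact: poweR_ge0.
  apply: (@le_trans _ _ (`|C|%:E * H1_norm (@bump R N l))%E).
    by apply: lee_wpmul2r => //; rewrite lee_fin ler_norm.
  apply: lee_wpmul2l; first by rewrite lee_fin.
  by apply: (le_trans (hB _ l1)); rewrite lee_fin ler_norm.
have := le_trans (bump_lower l0 (ltW q0)) (integral_weighted_le q0 hD).
rewrite lee_fin -/e /l -powRrM mulVf ?gt_eqF// powRr1 ?(ltW t0)//.
rewrite mulrDr mulr1 mulrCA mulfV ?gt_eqF// mulr1.
by rewrite leNgt ltrDl c0_gt0.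
Qed.

Lemma no_compact_embedding : ~ compact_embedding N gamma (crit_exp N gamma).
Proof.
set q := crit_exp N gamma; have q0 : 0 < q by exact: crit_exp_gt0.
have l0 k : 0 < (4 : R) ^+ k by rewrite exprn_gt0.
have [B hB] := @H1_norm_bump_bounded R N.
move=> /(_ (fun k => H1r_of_test (test_radial_bump N (l0 k)))
           (fun k => bump (4 ^+ k))) [|| s [v [hs [mv _] cv]]].
- by move=> k; exact: bump_represents.
- by exists B => k; rewrite H1r_norm_of_test; apply: hB; rewrite exprn_ege1// ler1n.
(* Chosen so that [2^q (d + d) = c0 q / 2], which is below the lower bound [c0 q] for every bump. *)
pose d := c0 q / (4 * 2 `^ q).
have two0 : 0 < (2 : R) `^ q by rewrite powR_gt0.
have d0 : 0 < d by rewrite divr_gt0// mulr_gt0.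
have e0 : (0 < (d `^ q^-1)%:E)%E by rewrite lte_fin powR_gt0.
pose w j : 'rV[R]_N -> R := bump (4 ^+ s j) \- v.
have [k _ hk] : \forall k \near \oo, (Lq_norm gamma q (w k) < (d `^ q^-1)%:E)%E.
  apply: (cv [set y | (y < (d `^ q^-1)%:E)%E]).
  exact: open_ereal_lt'.
have small j : (k <= j)%N -> (\int[@lebesgue_rV R N]_x
    (enorm x `^ gamma * `|w j x| `^ q)%:E <= d%:E)%E.
  move=> /hk/= /ltW/(integral_weighted_le q0).
  by rewrite -powRrM mulVf ?gt_eqF// powRr1 ?(ltW d0).
have mb j := measurable_elementary (@elementary_bump R N (4 ^+ s j)).
have := bump_lower (l0 (s k)) (ltW q0).
(* At the critical exponent the power of [l] is zero, so the lower bound is [c0 q] for all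
   scales. *)
rewrite subrr mul0r powRr0 mulr1 leNgt => /negP; apply.
apply: (@le_lt_trans _ _ ((2 `^ q)%:E * (d%:E + d%:E))%E); last first.
  rewrite -EFinD -EFinM lte_fin (_ : _ * _ = c0 q / 2).
    by rewrite ltr_pdivrMr// ltr_pMr// ltr1n.
  by rewrite /d; field; rewrite gt_eqF.
(* Two consecutive terms of the subsequence suffice: [s] is strictly increasing, so their scales
   differ by a factor of at least [4]. *)
apply: (le_trans (integral_le_of_disjoint gamma (ltW q0) (mb k) (mb k.+1) mv _)).
  move=> x; apply: bump_disjoint => //; first exact: ltnW.
  by rewrite -exprS ler_weXn2l ?ler1n// hs.
apply: lee_wpmul2l; first by rewrite lee_fin ltW.
by apply: leeD; exact: small.
Qed.

End critical_exponent.

Theorem theorem2p3 (R : realType) (N : nat) (gamma : R)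
    (hN : (3 <= N)%N) (hgamma : -2 <= gamma) :
  (forall q : R, crit_exp N gamma < q -> ~ embedding N gamma q) /\
  ~ compact_embedding N gamma (crit_exp N gamma).
Proof.
split; first exact: no_embedding.
exact: no_compact_embedding.
Qed.
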